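(* Let $N\ge 2$ and let $A=(a_{ij})_{N\times N}\in\mathbb{C}_{N\times N}$ be a lower triangular constant matrix. Let $\phi(x,t)=(\phi_1,\dots,\phi_N)^T$ be a vector of $C^\infty$ functions satisfying $$\phi_{xx}=-A\phi,\qquad \phi_t=-4\phi_{xxx}.$$ Let $\sigma_N=(0,\dots,0,1)^T\in\mathbb{C}^N$ be the $N$-th standard unit vector, and define the determinants $$g=|\phi,\ \partial_x\phi,\ \dots,\ \partial_x^{N-2}\phi,\ \sigma_N|,\qquad f=|\phi,\ \partial_x\phi,\ \dots,\ \partial_x^{N-1}\phi|.$$ Then, with $\lambda=-a_{NN}$, the pair $f,g$ satisfies the bilinear Bäcklund transformation $$D_x^2\,f\cdot g=\lambda fg,\qquad (D_x^3+D_t+3\lambda D_x)\,f\cdot g=0.$$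
   Context: Hirota's bilinear operator is defined by $D_x^mD_t^n\,f(x,t)\cdot g(x,t)=(\partial_x-\partial_{x'})^m(\partial_t-\partial_{t'})^n f(x,t)g(x',t')\big|_{x'=x,\,t'=t}$; e.g. $D_x^2 f\cdot g=f_{xx}g-2f_xg_x+fg_{xx}$. A determinant $|v_1,\dots,v_N|$ denotes the determinant of the $N\times N$ matrix with columns $v_1,\dots,v_N$. *)

(* Defs.v *)
From HB Require Import structures.
From mathcomp Require Import all_boot all_order all_algebra.
From mathcomp Require Export complex.
From mathcomp Require Import all_classical all_reals all_analysis.
Import numFieldNormedType.Exports.
Set Implicit Arguments. Unset Strict Implicit. Unset Printing Implicit Defensive.
Import Order.TTheory GRing.Theory Num.Theory.
Local Open Scope ring_scope.
Local Open Scope complex_scope.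

Section Defs.
Variable R : realType.

Definition dxR (F : R -> R -> R) : R -> R -> R :=
  fun x t => derive1 (fun y => F y t) x.
Definition dtR (F : R -> R -> R) : R -> R -> R :=
  fun x t => derive1 (fun s => F x s) t.

Definition dwordR (w : seq bool) (F : R -> R -> R) : R -> R -> R :=
  foldr (fun b G => if b then dxR G else dtR G) F w.

Definition smoothR (F : R -> R -> R) : Prop :=
  forall w : seq bool,
    (forall x t, derivable (fun y => dwordR w F y t) x 1 /\
                 derivable (fun s => dwordR w F x s) t 1) /\
    continuous (fun p : R * R => dwordR w F p.1 p.2).

Definition cRe (f : R -> R -> R[i]) : R -> R -> R := fun x t => complex.Re (f x t).
Definition cIm (f : R -> R -> R[i]) : R -> R -> R := fun x t => complex.Im (f x t).

Definition smoothC (f : R -> R -> R[i]) : Prop :=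
  smoothR (cRe f) /\ smoothR (cIm f).

Definition pdx (f : R -> R -> R[i]) : R -> R -> R[i] :=
  fun x t => (dxR (cRe f) x t) +i* (dxR (cIm f) x t).
Definition pdt (f : R -> R -> R[i]) : R -> R -> R[i] :=
  fun x t => (dtR (cRe f) x t) +i* (dtR (cIm f) x t).

Definition pdxn (k : nat) (f : R -> R -> R[i]) := iter k pdx f.
Definition pdtn (k : nat) (f : R -> R -> R[i]) := iter k pdt f.

(* Hirota's bilinear operator D_x^m D_t^n f.g, via the Leibniz expansion of
   (d_x - d_x')^m (d_t - d_t')^n f(x,t) g(x',t') at x'=x, t'=t *)
Definition hirota (m n : nat) (f g : R -> R -> R[i]) : R -> R -> R[i] :=
  fun x t =>
    \sum_(k < m.+1) \sum_(l < n.+1)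
      ((-1) ^+ (k + l) * ('C(m, k) * 'C(n, l))%:R) *
      (pdxn (m - k) (pdtn (n - l) f) x t * pdxn k (pdtn l g) x t).

End Defs.

(* Main.v *)
(* Let [F_r], [G_r] be the determinants [f], [g] with the order of the last
   derivative column raised by [r]. Acting on the columns one at a time, the
   power sums [p_r : phi^(a) |-> phi^(a+r)] satisfy Newton's identities
   [p_1 F_(n-1) + ... + p_n F_0 = n F_n]; here [p_1 = d/dx], [-4 p_3 = d/dt]
   on [F_0], and [p_2] is multiplication by the constant [- \tr A] because
   [phi_xx = - A phi]. As [A] is lower triangular, [g] is, up to expansion
   along its last column, the Wronskian of [phi_1, ..., phi_(N-1)], which
   solves the same system with [A] truncated, so that [p_2] acts on [f] and [g]
   by constants differing by [lambda]. The Pluecker relation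
   [F_0 G_(k+1) = F_k G_1 - (p_1 F_k - F_(k+1)) G_0] gives the first bilinear
   equation for [k = 1]; for [k = 2] it gives a combination of the second one
   and the [x]-derivative of the first. *)
Require Import Defs.
From HB Require Import structures.
From mathcomp Require Import all_boot all_order all_algebra.
From mathcomp Require Import perm complex ring lra zify.
From mathcomp Require Import all_classical all_reals all_analysis.
Import numFieldNormedType.Exports.
Set Implicit Arguments. Unset Strict Implicit. Unset Printing Implicit Defensive.
Import Order.TTheory GRing.Theory Num.Theory.
Local Open Scope ring_scope.

(** * Determinants with one column replaced *)

Section ColumnReplacement.
Context {K : comNzRingType} {N : nat}.
Implicit Types (M B : 'M[K]_N) (c : 'I_N -> K) (j : 'I_N).

Definition replace_col M j c : 'M[K]_N :=
  \matrix_(i, l) if l == j then c i else M i l.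

Lemma det_replace_col M j c :
  \det (replace_col M j c) = \sum_i c i * cofactor M i j.
Proof.
rewrite (expand_det_col _ j); apply: eq_bigr => i _.
rewrite mxE eqxx; congr (_ * (_ * \det _)).
by apply/matrixP => a b; rewrite !mxE eq_sym (negbTE (neq_lift _ _)).
Qed.

Lemma det_eq_col M j1 j2 :
  j1 != j2 -> (forall i, M i j1 = M i j2) -> \det M = 0.
Proof.
move=> neq eqM; rewrite -det_tr; apply: (determinant_alternate neq) => i.
by rewrite !mxE.
Qed.

Lemma det_xcol M j1 j2 : j1 != j2 -> \det (xcol j1 j2 M) = - \det M.
Proof.
by move=> neq; rewrite xcolE det_mulmx det_perm odd_tperm neq expr1 mulrN1.
Qed.

(** Cofactor expansion turns the sum into the trace of [\adj M *m (B *m M)]; cyclicity of the trace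
    and [M *m \adj M = (\det M)%:M] finish. *)
Lemma sum_det_replace_col M B :
  \sum_j \det (replace_col M j (fun i => (B *m M) i j)) = \tr B * \det M.
Proof.
transitivity (\tr (\adj M *m (B *m M))).
  rewrite /mxtrace; apply: eq_bigr => j _; rewrite det_replace_col [RHS]mxE.
  by apply: eq_bigr => i _; rewrite [LHS]mulrC [(\adj M) j i]mxE.
by rewrite mxtrace_mulC -mulmxA mul_mx_adj mul_mx_scalar mxtraceZ mulrC.
Qed.

(* Cramer's rule writes [\det M] times column [l] of [M'] as a combination of
   the columns of [M]. *)
Lemma det_exchange M M' l :
  \det M * \det M' =
  \sum_j \det (replace_col M j (fun i => M' i l)) *
         \det (replace_col M' l (fun i => M i j)).
Proof.
transitivity (\sum_i (\det M *: M') i l * cofactor M' i l).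
  rewrite (expand_det_col M' l) mulr_sumr.
  by apply: eq_bigr => i _; rewrite mxE mulrA.
rewrite -mul_scalar_mx -mul_mx_adj -mulmxA.
under eq_bigr do rewrite mxE mulr_suml.
rewrite exchange_big /=; apply: eq_bigr => j _.
rewrite !det_replace_col mulr_sumr; apply: eq_bigr => i _.
rewrite [LHS]mulrAC [LHS]mulrC; congr (_ * _).
by rewrite mxE; apply: eq_bigr => a _; rewrite mulrC [(\adj M) j a]mxE.
Qed.

End ColumnReplacement.

(** * Algebra of generalized Wronskians: Newton's identities and the Pluecker relation *)

Section Wronskian.
Context {K : numDomainType}.

(** [v a i] stands for the [a]-th derivative of the [i]-th function, and [k] lists the orders of the
    columns. For [v a i = x_i ^+ a] this is an alternant, whence the analogy with symmetric
    functions. *)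
Definition wr {N : nat} (v : nat -> 'I_N -> K) (k : 'I_N -> nat) : K :=
  \det (\matrix_(i, j) v (k j) i).

Definition raise_col {N : nat} (k : 'I_N -> nat) (j : 'I_N) (r : nat) : 'I_N -> nat :=
  fun l => if l == j then (k l + r)%N else k l.

(** The orders 0, ..., m-1, m+r of the one-row partition (r): the alternant is then the Vandermonde
    determinant times the complete homogeneous polynomial h_r. *)
Definition staircase (m r : nat) : 'I_m.+1 -> nat :=
  raise_col (@nat_of_ord m.+1) ord_max r.
#[global] Arguments staircase : clear implicits.

Lemma eq_wr N (v : nat -> 'I_N -> K) k k' : k =1 k' -> wr v k = wr v k'.
Proof.
by move=> e; congr (\det _); apply/matrixP => i j; rewrite !mxE e.
Qed.

Lemma wr_eq0 N (v : nat -> 'I_N -> K) k i j : i != j -> k i = k j -> wr v k = 0.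
Proof. by move=> neq e; apply: (det_eq_col neq) => l; rewrite !mxE e. Qed.

Lemma wr_swap N (v : nat -> 'I_N -> K) (k k' : 'I_N -> nat) i j : i != j ->
  k' i = k j -> k' j = k i -> (forall l, l != i -> l != j -> k' l = k l) ->
  wr v k' = - wr v k.
Proof.
move=> neq ei ej eo; rewrite /wr -(det_xcol _ neq); congr (\det _).
apply/matrixP => a l; rewrite !mxE.
by case: tpermP => [->|->|/eqP ? /eqP ?]; rewrite ?ei ?ej ?eo.
Qed.

Lemma wr_raise_col N (v : nat -> 'I_N -> K) k j r :
  wr v (raise_col k j r) =
  \det (replace_col (\matrix_(i, l) v (k l) i) j (fun i => v (k j + r)%N i)).
Proof.
congr (\det _); apply/matrixP => i l; rewrite !mxE /raise_col.
by case: eqP => // ->.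
Qed.

Lemma wr_staircase0 m (v : nat -> 'I_m.+1 -> K) :
  wr v (staircase m 0) = wr v (@nat_of_ord _).
Proof. by apply: eq_wr => l; rewrite /staircase /raise_col addn0 if_same. Qed.

(* Writing [a] for the degree in column [j], the terms with [a < m] have a
   repeated column, and [a |-> m + n + j - a] swaps columns [j] and [m]. *)
Lemma newton_off m (v : nat -> 'I_m.+1 -> K) (n : nat) (j : 'I_m.+1) :
  j != ord_max ->
  \sum_(r < n) wr v (raise_col (staircase m (n - r.+1)) j r.+1) = 0.
Proof.
move=> jm.
have ltjm : (j < m)%N.
  by have := ltn_ord j; have : (j : nat) != m by []; lia.
pose X a := wr v (fun l : 'I_m.+1 =>
  if l == j then a else if l == ord_max then (m + n + j - a)%N else l).
have -> : \sum_(r < n) wr v (raise_col (staircase m (n - r.+1)) j r.+1) =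
          \sum_(j.+1 <= a < j.+1 + n) X a.
  rewrite -[X in \sum_(X <= _ < _) _]add0n big_addn addKn big_mkord.
  apply: eq_bigr => r _; apply: eq_wr => l; rewrite /raise_col /staircase /raise_col.
  case: eqP => [->|_]; first by rewrite (negbTE jm); lia.
  by case: eqP => [->/=|//]; have := ltn_ord r; lia.
have X0 a : (j < a)%N -> (a < m)%N -> X a = 0.
  move=> ja am; have am' : (a < m.+1)%N by lia.
  apply: (@wr_eq0 _ _ _ j (Ordinal am')).
    by rewrite -val_eqE /=; lia.
  have -> : (Ordinal am' == j) = false by rewrite -val_eqE /=; lia.
  have -> : (Ordinal am' == ord_max) = false by rewrite -val_eqE /=; lia.
  by rewrite eqxx.
(* A short range stays below [m], so all its terms vanish. Otherwise the terms from [m] to [j + n]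
   remain, a range that the reversal preserves, and the sum equals its own opposite. *)
have [le|lt] := leqP m (j.+1 + n); last first.
  by rewrite big_nat_cond big1 // => a /andP[/andP[? ?] _]; apply: X0; lia.
rewrite (@big_cat_nat _ _ _ m) //=.
rewrite [X in X + _]big_nat_cond [X in X + _]big1 ?add0r; last first.
  by move=> a /andP[/andP[? ?] _]; apply: X0.
set S := \sum_(_ <= _ < _) _.
suff : S = - S by move/eqP; rewrite -subr_eq0 opprK -mulr2n mulrn_eq0 => /eqP.
rewrite {1}/S big_nat_rev -sumrN; apply: eq_big_nat => a /andP[ma an].
apply: (wr_swap _ jm) => [||l /negbTE -> /negbTE -> //].
  by rewrite eqxx eq_sym (negbTE jm) eqxx; lia.
by rewrite eq_sym (negbTE jm) !eqxx; lia.
Qed.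

(** Only the last column contributes, by [newton_off]; there each of the [n] terms raises the order
    to [m + n]. *)
Lemma newton m (v : nat -> 'I_m.+1 -> K) n :
  \sum_(0 <= r < n) \sum_j wr v (raise_col (staircase m (n - r.+1)) j r.+1) =
  n%:R * wr v (staircase m n).
Proof.
rewrite big_mkord exchange_big (bigD1 ord_max) //= [X in _ + X]big1 ?addr0; last first.
  by move=> j; exact: newton_off.
rewrite -[n in RHS]card_ord mulr_natl -sumr_const; apply: eq_bigr => r _.
apply: eq_wr => l; rewrite /staircase /raise_col.
by rewrite card_ord; case: eqP => //= ->; have := ltn_ord r; lia.
Qed.

(** Raising a column by two multiplies it by [- A], so [sum_det_replace_col] applies with
    [B := - A]. *)
Lemma wr_mul_trace N (v : nat -> 'I_N -> K) (A : 'M[K]_N) k :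
  (forall a i, v a.+2 i = - \sum_j A i j * v a j) ->
  \sum_j wr v (raise_col k j 2) = - \tr A * wr v k.
Proof.
move=> vA; rewrite -raddfN /= -sum_det_replace_col; apply: eq_bigr => j _.
rewrite wr_raise_col; congr (\det _); apply/matrixP => i l; rewrite !mxE.
case: eqP => // _; rewrite addn2 vA -sumrN.
by apply: eq_bigr => b _; rewrite !mxE mulNr.
Qed.

Definition drop_last {n} (v : nat -> 'I_n.+2 -> K) : nat -> 'I_n.+1 -> K :=
  fun a i => v a (lift ord_max i).

Lemma det_bordered n (v : nat -> 'I_n.+2 -> K) (k : 'I_n.+2 -> nat) :
  \det (\matrix_(i, j) if j == ord_max then (i == ord_max)%:R else v (k j) i) =
  wr (drop_last v) (k \o lift ord_max).
Proof.
rewrite (expand_det_col _ ord_max) (bigD1 ord_max) //= big1; last first.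
  by move=> i /negbTE ni; rewrite !mxE eqxx ni mul0r.
rewrite !mxE !eqxx mul1r addr0 /cofactor exprD -expr2 sqrr_sign mul1r.
congr (\det _); apply/matrixP => i j; rewrite !mxE.
by rewrite eq_sym (negbTE (neq_lift _ _)).
Qed.

(** The Wronskian matrix and the bordered matrix share the columns of order below [n], so in
    [det_exchange] only two terms survive. *)
Lemma plucker n (v : nat -> 'I_n.+2 -> K) r :
  wr v (@nat_of_ord _) * wr (drop_last v) (staircase n r.+1) =
  wr v (staircase n.+1 r) * wr (drop_last v) (staircase n 1) -
  (\sum_j wr v (raise_col (staircase n.+1 r) j 1) - wr v (staircase n.+1 r.+1)) *
  wr (drop_last v) (@nat_of_ord _).
Proof.
(* [p] is the last but one column, of order [n]; [B s] is the bordered matrix whose column [p] has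
   order [s]. *)
pose p : 'I_n.+2 := lift ord_max ord_max.
have pE : (p : nat) = n by rewrite /= /bump leqNgt ltnS leqnn.
have pm : p != ord_max by rewrite eq_sym neq_lift.
pose B (s : nat) : 'M[K]_n.+2 := \matrix_(i, j)
  if j == ord_max then (i == ord_max)%:R else v (if j == p then s else j : nat) i.
have BE s : (n <= s)%N -> \det (B s) = wr (drop_last v) (staircase n (s - n)).
  move=> ns; rewrite det_bordered; apply: eq_wr => l /=.
  rewrite /staircase /raise_col (inj_eq lift_inj); case: eqP => [->|_] /=; first lia.
  by rewrite /bump leqNgt ltn_ord.
have BR s t : replace_col (B s) p (v t) = B t.
  apply/matrixP => i j; rewrite !mxE.
  by case: eqP => // ->; rewrite (negbTE pm).
set M : 'M[K]_n.+2 := \matrix_(i, j) v j i.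
have -> : wr v (@nat_of_ord _) = \det M by [].
have {1}-> : r.+1 = (n + r.+1 - n)%N by lia.
rewrite -BE ?leq_addr // (det_exchange _ _ p) /=.
have colB : (fun i => B (n + r.+1)%N i p) = v (n + r.+1)%N.
  by apply/funext => i; rewrite mxE (negbTE pm) eqxx.
have colM j : (fun i => M i j) = v j by apply/funext => i; rewrite mxE.
under eq_bigr do rewrite colB colM BR.
(* For [j < n], the matrix [B j] has the column of order [j] twice. *)
rewrite (bigD1 ord_max) //= (bigD1 p) //= big1 ?addr0; last first.
  move=> j /andP[jm jp]; rewrite (_ : \det (B j) = 0) ?mulr0 //.
  apply: (det_eq_col jp) => i; rewrite !mxE.
  by rewrite (negbTE jm) (negbTE pm) (negbTE jp) eqxx.
rewrite [bump _ _]pE !BE // subnn subSnn wr_staircase0; congr (_ * _ + _).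
  rewrite wr_raise_col; congr (\det (replace_col _ _ _)).
  by apply/funext => i /=; congr (v _ i); lia.
rewrite -mulNr; congr (_ * _).
(* Raising a column [j < n] by one repeats column [j.+1]. The term of [ord_max] cancels the
   subtracted determinant, and that of [p] is the exchanged determinant up to a swap of the last two
   columns. *)
rewrite (bigD1 ord_max) //= (bigD1 p) //= big1 ?addr0; last first.
  move=> j /andP[jm jp].
  have jn : (j < n)%N.
    have := ltn_ord j; have : (j : nat) != n.+1 by [].
    by have : (j : nat) != n; [move: jp; rewrite -val_eqE [val p]pE | lia].
  have jn' : (j.+1 < n.+2)%N by lia.
  apply: (@wr_eq0 _ _ _ j (Ordinal jn')).
    by rewrite -val_eqE /=; lia.
  rewrite /staircase /raise_col eqxx (negbTE jm).
  have -> : (Ordinal jn' == j) = false by rewrite -val_eqE /=; lia.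
  have -> : (Ordinal jn' == ord_max) = false by rewrite -val_eqE /=; lia.
  by rewrite addn1.
have -> : wr v (raise_col (staircase n.+1 r) ord_max 1) = wr v (staircase n.+1 r.+1).
  by apply: eq_wr => l; rewrite /staircase /raise_col; case: eqP => //; lia.
rewrite addrAC subrr add0r.
have -> : \det (replace_col M p (v (n + r.+1)%N)) =
    wr v (raise_col (@nat_of_ord _) p r.+1).
  rewrite wr_raise_col; congr (\det (replace_col _ _ _)).
  by apply/funext => i; rewrite pE.
apply: (wr_swap _ pm) => [||l /negbTE lp /negbTE lm];
  rewrite /staircase /raise_col ?eqxx ?lp ?lm // ?(negbTE pm) // 1?eq_sym ?(negbTE pm) //;
  by rewrite ?eqxx /= [bump _ _]pE; lia.
Qed.

End Wronskian.

(** * Symmetry of mixed partial derivatives *)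

Section Clairaut.
Context {R : realType}.
Implicit Types (F : R -> R -> R) (x t h : R).

(** The mean value theorem is applied in [x] to the increment of [F] in [t], then in [t] to
    [dxR F]. *)
Lemma mixed_mvt F x t h : 0 < h ->
  (forall y s, derivable (F ^~ s) y 1) ->
  (forall y s, derivable (dxR F y) s 1) ->
  exists p q, [/\ x < p < x + h, t < q < t + h &
    F (x + h) (t + h) - F (x + h) t - (F x (t + h) - F x t) =
    dtR (dxR F) p q * h * h].
Proof.
move=> h0 dF dFx.
have lt_add y : y < y + h by rewrite ltrDl.
pose f y := F y (t + h) - F y t.
have df (y : R) : is_derive y 1 f (dxR F y (t + h) - dxR F y t).
  apply: (@is_deriveB _ _ _ (F ^~ (t + h)) (F ^~ t));
    rewrite /dxR derive1E; apply: derivableP; exact: dF.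
have [p px ->] : exists2 p, p \in `]x, x + h[ &
    f (x + h) - f x = (dxR F p (t + h) - dxR F p t) * (x + h - x).
  apply: MVT => [//|].
  by apply: derivable_within_continuous => y _; have [] := df y.
have [q qt ->] : exists2 q, q \in `]t, t + h[ &
    dxR F p (t + h) - dxR F p t = dtR (dxR F) p q * (t + h - t).
  apply: (@MVT _ (dxR F p) (dtR (dxR F) p)) => [//|s _|].
    by rewrite /dtR derive1E; apply: derivableP; exact: dFx.
  by apply: derivable_within_continuous => s _; exact: dFx.
exists p, q; split; [by rewrite in_itv in px|by rewrite in_itv in qt|ring].
Qed.

(** The second difference over a square is symmetric in the two variables, so the two mixed
    derivatives agree at some points of arbitrarily small squares; continuity carries this to the
    corner. *)
Lemma clairaut F x t : smoothR F -> dxR (dtR F) x t = dtR (dxR F) x t.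
Proof.
move=> sF.
have [d0 _] := sF [::].
have [dx _] := sF [:: true].
have [dt _] := sF [:: false].
have [_ /(_ (x, t)) ctx] := sF [:: false; true].
have [_ /(_ (x, t)) cxt] := sF [:: true; false].
apply/eqP; rewrite -subr_eq0 -normr_le0; apply/ler_addgt0Pr => e e0.
rewrite add0r.
have tri (a b c c' : R) :
    c = c' -> `|b - c| < e / 2 -> `|a - c'| < e / 2 -> `|a - b| <= e.
  by move=> <-; rewrite !ltr_norml ler_norml => /andP[? ?] /andP[? ?]; lra.
have e20 : 0 < e / 2 by rewrite divr_gt0.
move/cvgrPdist_lt : ctx => /(_ _ e20) /= ntx.
move/cvgrPdist_lt : cxt => /(_ _ e20) /= nxt.
have [d /= d_gt0 nd] := (nbhs_ballP _ _).1 (filterI ntx nxt).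
have h0 : 0 < d / 2 by rewrite divr_gt0.
have inball p q : x < p < x + d / 2 -> t < q < t + d / 2 -> ball (x, t) d (p, q).
  move=> /andP[? ?] /andP[? ?]; split; rewrite /ball /= ltr_norml; apply/andP; split; lra.
have [p [q [px qt e1]]] := @mixed_mvt F x t (d / 2) h0
  (fun y s => (d0 y s).1) (fun y s => (dx y s).2).
(* The same second difference with the two variables exchanged. *)
have [q' [p' [qt' px' e2]]] := @mixed_mvt (fun s y => F y s) t x (d / 2) h0
  (fun s y => (d0 y s).2) (fun s y => (dt y s).1).
have [/= b1 _] := nd _ (inball _ _ px qt).
have [/= _ b2] := nd _ (inball _ _ px' qt').
have eqm : dtR (dxR F) p q = dxR (dtR F) p' q'.
  apply: (mulIf (lt0r_neq0 h0)); apply: (mulIf (lt0r_neq0 h0)).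
  apply: (etrans (esym e1)); apply: (etrans _ e2).
  move: (F _ _) (F _ _) (F _ _) (F _ _) => a b c a'; ring.
exact: tri eqm b1 b2.
Qed.

End Clairaut.

(** * Derivatives of complex-valued functions of a real variable *)

Section ComplexDerivative.
Context {R : realType}.
Implicit Types (h : R -> R[i]) (x : R) (d : R[i]).

(** Componentwise like [pdx] and [pdt], but it also asserts that the derivative exists, as the
    product and sum rules require. *)
Definition is_cderive h x d : Prop :=
  is_derive x 1 (fun y => complex.Re (h y)) (complex.Re d) /\
  is_derive x 1 (fun y => complex.Im (h y)) (complex.Im d).

Lemma is_cderive_eq h x d d' : is_cderive h x d -> d = d' -> is_cderive h x d'.
Proof. by move=> ? <-. Qed.

Lemma is_cderive_unique h x d d' : is_cderive h x d -> is_cderive h x d' -> d = d'.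
Proof.
move: d d' => [a b] [a' b'] [/= ra ib] [/= ra' ib'].
rewrite -(@derive_val _ _ _ _ _ _ _ ra) -(@derive_val _ _ _ _ _ _ _ ra').
by rewrite -(@derive_val _ _ _ _ _ _ _ ib) -(@derive_val _ _ _ _ _ _ _ ib').
Qed.

Lemma is_cderive_cst c x : is_cderive (fun=> c) x 0.
Proof. by split; exact: is_derive_cst. Qed.

Lemma is_cderiveD h1 h2 x d1 d2 : is_cderive h1 x d1 -> is_cderive h2 x d2 ->
  is_cderive (fun y => h1 y + h2 y) x (d1 + d2).
Proof.
move=> [r1 i1] [r2 i2]; split; rewrite raddfD.
  by under eq_fun do rewrite raddfD; exact: is_deriveD.
by under eq_fun do rewrite raddfD; exact: is_deriveD.
Qed.

Lemma is_cderiveM h1 h2 x d1 d2 : is_cderive h1 x d1 -> is_cderive h2 x d2 ->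
  is_cderive (fun y => h1 y * h2 y) x (d1 * h2 x + h1 x * d2).
Proof.
have ReM (a b : R[i]) : complex.Re (a * b) =
    complex.Re a * complex.Re b - complex.Im a * complex.Im b.
  by case: a b => ? ? [].
have ImM (a b : R[i]) : complex.Im (a * b) =
    complex.Re a * complex.Im b + complex.Im a * complex.Re b.
  by case: a b => ? ? [].
move=> [r1 i1] [r2 i2]; split.
  under eq_fun do rewrite ReM.
  apply: (is_derive_eq (is_deriveB (is_deriveM r1 r2) (is_deriveM i1 i2))).
  by rewrite [RHS]raddfD /= !ReM /= /GRing.scale /=; ring.
under eq_fun do rewrite ImM.
apply: (is_derive_eq (is_deriveD (is_deriveM r1 i2) (is_deriveM i1 r2))).
by rewrite [RHS]raddfD /= !ImM /= /GRing.scale /=; ring.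
Qed.

Lemma is_cderiveZ c h x d :
  is_cderive h x d -> is_cderive (fun y => c * h y) x (c * d).
Proof.
move=> dh; apply: is_cderive_eq (is_cderiveM (is_cderive_cst c x) dh) _.
by rewrite mul0r add0r.
Qed.

Lemma is_cderive_sum (I : Type) (r : seq I) (h : I -> R -> R[i]) x (d : I -> R[i]) :
  (forall i, is_cderive (h i) x (d i)) ->
  is_cderive (fun y => \sum_(i <- r) h i y) x (\sum_(i <- r) d i).
Proof.
move=> dh; elim: r => [|a r IH].
  under eq_fun do rewrite big_nil.
  by rewrite big_nil; exact: is_cderive_cst.
under eq_fun do rewrite big_cons.
by rewrite big_cons; exact: is_cderiveD.
Qed.

(** With [uniq r], the test [i == k] selects exactly one factor to differentiate. *)
Lemma is_cderive_prod (I : eqType) (r : seq I) (h : I -> R -> R[i]) x (d : I -> R[i]) :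
  uniq r -> (forall i, is_cderive (h i) x (d i)) ->
  is_cderive (fun y => \prod_(i <- r) h i y) x
    (\sum_(k <- r) \prod_(i <- r) if i == k then d i else h i x).
Proof.
move=> + dh; elim: r => [_|a r IH /= /andP[ar ur]].
  under eq_fun do rewrite big_nil.
  by rewrite big_nil; exact: is_cderive_cst.
under eq_fun do rewrite big_cons.
apply: is_cderive_eq (is_cderiveM (dh a) (IH ur)) _.
rewrite big_cons big_cons eqxx mulr_sumr; congr (_ * _ + _).
  by apply: eq_big_seq => i ir; case: eqP => // ia; rewrite -ia ir in ar.
apply: eq_big_seq => k kr; rewrite big_cons; case: eqP => // ka.
by rewrite ka kr in ar.
Qed.

Lemma is_cderive_det N (M : R -> 'M[R[i]]_N) x (d : 'I_N -> 'I_N -> R[i]) :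
  (forall i j, is_cderive (fun y => M y i j) x (d i j)) ->
  is_cderive (fun y => \det (M y)) x
    (\sum_j \det (\matrix_(i, l) if l == j then d i l else M x i l)).
Proof.
move=> dM; apply: is_cderive_eq.
  apply: is_cderive_sum => s; apply: is_cderiveZ.
  by apply: is_cderive_prod => [|i]; [exact: index_enum_uniq|exact: dM].
under eq_bigr do rewrite mulr_sumr.
(* The product rule singles out a row; reindexing by the inverse permutation singles out a column
   instead. *)
under eq_bigr => s _ do rewrite (reindex_inj (@perm_inj _ s^-1)) /=.
rewrite exchange_big; apply: eq_bigr => j _; apply: eq_bigr => s _.
congr (_ * _); apply: eq_bigr => i _; rewrite mxE.
by rewrite -(inj_eq (@perm_inj _ s)) permKV.
Qed.

Lemma pdx_is_cderive (F : R -> R -> R[i]) x t d :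
  is_cderive (F ^~ t) x d -> pdx F x t = d.
Proof.
by case: d => a b [/= ra ib]; congr (_ +i* _)%C; rewrite /dxR derive1E;
  apply: derive_val.
Qed.

Lemma pdt_is_cderive (F : R -> R -> R[i]) x t d :
  is_cderive (F x) t d -> pdt F x t = d.
Proof.
by case: d => a b [/= ra ib]; congr (_ +i* _)%C; rewrite /dtR derive1E;
  apply: derive_val.
Qed.

Lemma cRe_pdxn k (F : R -> R -> R[i]) : cRe (pdxn k F) = dwordR (nseq k true) (cRe F).
Proof. by elim: k => //= k <-. Qed.

Lemma cIm_pdxn k (F : R -> R -> R[i]) : cIm (pdxn k F) = dwordR (nseq k true) (cIm F).
Proof. by elim: k => //= k <-. Qed.

Lemma smoothC_is_cderive_x (F : R -> R -> R[i]) k x t : smoothC F ->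
  is_cderive (pdxn k F ^~ t) x (pdxn k.+1 F x t).
Proof.
move=> [sr si]; split => /=; rewrite /dxR derive1E; apply: derivableP.
  by have [/(_ x t)[+ _] _] := sr (nseq k true); rewrite -cRe_pdxn.
by have [/(_ x t)[+ _] _] := si (nseq k true); rewrite -cIm_pdxn.
Qed.

Lemma smoothC_is_cderive_t (F : R -> R -> R[i]) k x t : smoothC F ->
  is_cderive (pdxn k F x) t (pdt (pdxn k F) x t).
Proof.
move=> [sr si]; split => /=; rewrite /dtR derive1E; apply: derivableP.
  by have [/(_ x t)[_ +] _] := sr (nseq k true); rewrite -cRe_pdxn.
by have [/(_ x t)[_ +] _] := si (nseq k true); rewrite -cIm_pdxn.
Qed.

Lemma pdxC (F : R -> R -> R[i]) x t : smoothC F -> pdt (pdx F) x t = pdx (pdt F) x t.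
Proof.
move=> [sr si].
exact: (f_equal2 (@complex.Complex R) (esym (clairaut x t sr)) (esym (clairaut x t si))).
Qed.

End ComplexDerivative.

(** * Derivatives in [x] and [t] of the Wronskians of a solution *)

Section WronskianFlow.
Context {R : realType} {m : nat}.
Variables (A : 'M[R[i]]_m.+1) (phi : 'I_m.+1 -> R -> R -> R[i]).
Hypothesis phi_smooth : forall i, smoothC (phi i).
Hypothesis phi_xx :
  forall i x t, pdxn 2 (phi i) x t = - \sum_j A i j * phi j x t.
Hypothesis phi_t : forall i x t, pdt (phi i) x t = - 4%:R * pdxn 3 (phi i) x t.

Definition jet (x t : R) : nat -> 'I_m.+1 -> R[i] := fun a i => pdxn a (phi i) x t.

Definition wtau (r : nat) (x t : R) : R[i] := wr (jet x t) (staircase m r).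

Definition wtau_x (r : nat) (x t : R) : R[i] :=
  \sum_j wr (jet x t) (raise_col (staircase m r) j 1).

Lemma pdxnSS a i x t : pdxn a.+2 (phi i) x t = - \sum_j A i j * pdxn a (phi j) x t.
Proof.
elim: a i x t => [|a IH] i x t; first exact: phi_xx.
have -> : pdxn a.+3 (phi i) x t =
    pdx (fun y s => -1 * \sum_j A i j * pdxn a (phi j) y s) x t.
  rewrite -[LHS]/(pdx (pdxn a.+2 (phi i)) x t); congr (pdx _ x t).
  by apply/funext => y; apply/funext => s; rewrite IH mulN1r.
rewrite -[RHS]mulN1r; apply: pdx_is_cderive; apply: is_cderiveZ.
by apply: is_cderive_sum => j; apply: is_cderiveZ; exact: smoothC_is_cderive_x.
Qed.

(** Two-step induction: [pdxnSS] reduces order [a.+2] to order [a], so the derivatives need to be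
    commuted only for order one, by [pdxC]. *)
Lemma pdt_pdxn a i x t : pdt (pdxn a (phi i)) x t = - 4%:R * pdxn (a + 3) (phi i) x t.
Proof.
suff : (forall i x t, pdt (pdxn a (phi i)) x t = - 4%:R * pdxn (a + 3) (phi i) x t) /\
  (forall i x t, pdt (pdxn a.+1 (phi i)) x t = - 4%:R * pdxn (a.+1 + 3) (phi i) x t).
  by case.
elim: a => [|a [IH0 IH1]]; split=> {}i {}x {}t.
- exact: phi_t.
- rewrite -[pdxn 1 _]/(pdx (phi i)) (pdxC _ _ (phi_smooth i)).
  have -> : pdt (phi i) = fun y s => - 4%:R * pdxn 3 (phi i) y s.
    by apply/funext => y; apply/funext => s.
  by apply: pdx_is_cderive; apply: is_cderiveZ; exact: smoothC_is_cderive_x.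
- exact: IH1.
- have -> : pdxn a.+2 (phi i) = fun y s => -1 * \sum_j A i j * pdxn a (phi j) y s.
    by apply/funext => y; apply/funext => s; rewrite mulN1r pdxnSS.
  rewrite !addSn pdxnSS mulrN -[RHS]mulN1r; apply: pdt_is_cderive.
  apply: is_cderiveZ; rewrite mulr_sumr; apply: is_cderive_sum => j.
  rewrite mulrCA -IH0; apply: is_cderiveZ; exact: smoothC_is_cderive_t.
Qed.

Lemma is_cderive_wr_x k x t :
  is_cderive (fun y => wr (jet y t) k) x (\sum_j wr (jet x t) (raise_col k j 1)).
Proof.
apply: is_cderive_eq.
  apply: is_cderive_det => i j; under eq_fun do rewrite mxE.
  exact: smoothC_is_cderive_x.
apply: eq_bigr => j _; congr (\det _); apply/matrixP => i l; rewrite !mxE.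
by rewrite /raise_col; case: eqP => // _; rewrite addn1.
Qed.

Lemma is_cderive_wr_t k x t :
  is_cderive (fun s => wr (jet x s) k) t
    (- 4%:R * \sum_j wr (jet x t) (raise_col k j 3)).
Proof.
apply: is_cderive_eq.
  apply: is_cderive_det => i j; under eq_fun do rewrite mxE.
  exact: smoothC_is_cderive_t.
rewrite mulr_sumr; apply: eq_bigr => j _.
transitivity (\det (replace_col (\matrix_(i, l) jet x t (k l) i) j
   (fun i => - 4%:R * jet x t (k j + 3) i))).
  congr (\det _); apply/matrixP => i l; rewrite !mxE.
  by case: eqP => // ->; rewrite pdt_pdxn.
rewrite wr_raise_col !det_replace_col mulr_sumr.
by apply: eq_bigr => i _; rewrite [RHS]mulrA.
Qed.

Lemma wtau_x0 x t : wtau_x 0 x t = wtau 1 x t.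
Proof. by have := newton (jet x t) 1; rewrite big_nat1 mul1r. Qed.

(** Newton's identity for [n = 2], with [p_2] acting as [- \tr A]. *)
Lemma wtau_x1 x t : wtau_x 1 x t = 2 * wtau 2 x t - (- \tr A) * wtau 0 x t.
Proof.
have := newton (jet x t) 2; rewrite big_nat_recl // big_nat1.
rewrite (wr_mul_trace (A := A)) => [<-|a i]; last exact: pdxnSS.
by rewrite addrK.
Qed.

Lemma is_cderive_wtau r x t : is_cderive (wtau r ^~ t) x (wtau_x r x t).
Proof. exact: is_cderive_wr_x. Qed.

(** Newton's identity for [n = 3], solved for [p_3] and multiplied by -4. The term [wtau_x 2] is
    kept as an unknown, to be eliminated in the final computation. *)
Lemma is_cderive_wtau_t x t : is_cderive (wtau 0 x) t
  (4 * wtau_x 2 x t + 4 * (- \tr A) * wtau 1 x t - 12 * wtau 3 x t).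
Proof.
apply: is_cderive_eq; first exact: is_cderive_wr_t.
have := newton (jet x t) 3; rewrite !big_nat_recl // big_geq // addr0.
rewrite (wr_mul_trace (A := A)) => [e|a i]; last exact: pdxnSS.
have {e} : wtau_x 2 x t + (- \tr A * wtau 1 x t +
   \sum_j wr (jet x t) (raise_col (staircase m 0) j 3)) = 3%:R * wtau 3 x t := e.
by move=> /(canRL (addKr _))/(canRL (addKr _)) ->; ring.
Qed.

Lemma wr_jet x t : wr (jet x t) (@nat_of_ord _) = wtau 0 x t.
Proof. by rewrite /wtau wr_staircase0. Qed.

Lemma pdx_wtau0 : pdx (wtau 0) = wtau 1.
Proof.
apply/funext => x; apply/funext => t; rewrite -wtau_x0.
by apply: pdx_is_cderive; exact: is_cderive_wtau.
Qed.

Lemma pdx_wtau1 :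
  pdx (wtau 1) = fun x t => 2 * wtau 2 x t + \tr A * wtau 0 x t.
Proof.
apply/funext => x; apply/funext => t.
rewrite -[_ * wtau 0 x t]opprK -mulNr -wtau_x1.
by apply: pdx_is_cderive; exact: is_cderive_wtau.
Qed.

Lemma pdx_pdx_wtau1 x t :
  pdx (pdx (wtau 1)) x t = 2 * wtau_x 2 x t + \tr A * wtau 1 x t.
Proof.
rewrite pdx_wtau1 -wtau_x0; apply: pdx_is_cderive.
by apply: is_cderiveD; apply: is_cderiveZ; exact: is_cderive_wtau.
Qed.

Lemma pdt_wtau0 x t : pdt (wtau 0) x t =
  4 * wtau_x 2 x t - 4 * \tr A * wtau 1 x t - 12 * wtau 3 x t.
Proof.
rewrite (pdt_is_cderive (is_cderive_wtau_t x t)).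
by rewrite mulrN mulNr.
Qed.

End WronskianFlow.

(** * Explicit low-order Hirota derivatives *)

Section HirotaExpansion.
Context {R : realType}.
Implicit Types (f g : R -> R -> R[i]).

Lemma hirota_xE n f g x t : hirota n 0 f g x t =
  \sum_(k < n.+1) (-1) ^+ k * 'C(n, k)%:R * (pdxn (n - k) f x t * pdxn k g x t).
Proof.
by apply: eq_bigr => k _; rewrite big_ord1 addn0 bin0 muln1.
Qed.

Lemma hirota_x f g x t :
  hirota 1 0 f g x t = pdx f x t * g x t - f x t * pdx g x t.
Proof.
(* Arbitrary sequences keep the iterated derivatives folded while the binomial sum is expanded. *)
have E (a b : nat -> R[i]) :
    \sum_(k < 2) (-1) ^+ k * 'C(1, k)%:R * (a (1 - k)%N * b k) =
    a 1%N * b 0%N - a 0%N * b 1%N.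
  rewrite !big_ord_recl big_ord0 /= /bump /=.
  by rewrite !(addn0, add1n, bin0, binn); ring.
by rewrite hirota_xE (E (fun k => pdxn k f x t) (fun k => pdxn k g x t)).
Qed.

Lemma hirota_xx f g x t : hirota 2 0 f g x t =
  pdx (pdx f) x t * g x t - 2 * pdx f x t * pdx g x t + f x t * pdx (pdx g) x t.
Proof.
have E (a b : nat -> R[i]) :
    \sum_(k < 3) (-1) ^+ k * 'C(2, k)%:R * (a (2 - k)%N * b k) =
    a 2%N * b 0%N - 2 * a 1%N * b 1%N + a 0%N * b 2%N.
  rewrite !big_ord_recl big_ord0 /= /bump /=.
  by rewrite !(addn0, add1n, bin0, bin1, binn); ring.
by rewrite hirota_xE (E (fun k => pdxn k f x t) (fun k => pdxn k g x t)).
Qed.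

Lemma hirota_xxx f g x t : hirota 3 0 f g x t =
  pdx (pdx (pdx f)) x t * g x t - 3 * pdx (pdx f) x t * pdx g x t
  + 3 * pdx f x t * pdx (pdx g) x t - f x t * pdx (pdx (pdx g)) x t.
Proof.
have E (a b : nat -> R[i]) :
    \sum_(k < 4) (-1) ^+ k * 'C(3, k)%:R * (a (3 - k)%N * b k) =
    a 3%N * b 0%N - 3 * a 2%N * b 1%N + 3 * a 1%N * b 2%N - a 0%N * b 3%N.
  rewrite !big_ord_recl big_ord0 /= /bump /=.
  by rewrite !(addn0, add1n, bin0, bin1, binn, binS); ring.
by rewrite hirota_xE (E (fun k => pdxn k f x t) (fun k => pdxn k g x t)).
Qed.

Lemma hirota_t f g x t :
  hirota 0 1 f g x t = pdt f x t * g x t - f x t * pdt g x t.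
Proof.
rewrite /hirota big_ord1 !big_ord_recl big_ord0 /= /bump /=.
by rewrite !(addn0, add1n, bin0, binn, muln1); ring.
Qed.

End HirotaExpansion.

(** * The bilinear Bäcklund transformation *)

Unset Implicit Arguments. Set Strict Implicit.

Theorem theorem3p2p1 (R : realType) (n : nat)
  (A : 'M[R[i]]_(n.+2)) (phi : 'I_(n.+2) -> R -> R -> R[i]) :
  (* A is lower triangular *)
  (forall i j : 'I_(n.+2), (i < j)%N -> A i j = 0) ->
  (* phi is C^infinity *)
  (forall i, smoothC (phi i)) ->
  (* phi_xx = - A phi *)
  (forall i x t, pdxn 2 (phi i) x t = - \sum_j A i j * phi j x t) ->
  (* phi_t = - 4 phi_xxx *)
  (forall i x t, pdt (phi i) x t = - 4%:R * pdxn 3 (phi i) x t) ->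
  let f : R -> R -> R[i] := fun x t =>
    \det (\matrix_(i < n.+2, j < n.+2) pdxn j (phi i) x t) in
  let g : R -> R -> R[i] := fun x t =>
    \det (\matrix_(i < n.+2, j < n.+2)
           (if j == ord_max then (i == ord_max)%:R else pdxn j (phi i) x t)) in
  let lambda : R[i] := - A ord_max ord_max in
  forall x t : R,
    hirota 2 0 f g x t = lambda * f x t * g x t /\
    hirota 3 0 f g x t + hirota 0 1 f g x t + 3%:R * lambda * hirota 1 0 f g x t = 0.
Proof.
move=> A_trig phi_smooth phi_xx phi_t f g lambda.
pose phi' (i : 'I_n.+1) := phi (lift ord_max i).
pose A' : 'M[R[i]]_n.+1 := \matrix_(i, j) A (lift ord_max i) (lift ord_max j).
have lift_widen (i : 'I_n.+1) : widen_ord (leqnSn n.+1) i = lift ord_max i.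
  by apply: val_inj; rewrite /= /bump leqNgt ltn_ord.
have trA : \tr A = \tr A' - lambda.
  rewrite /mxtrace big_ord_recr opprK; congr (_ + _).
  by apply: eq_bigr => i _; rewrite lift_widen mxE.
have phi'_smooth i : smoothC (phi' i) by exact: phi_smooth.
(* Triangularity makes the system of the first N-1 functions closed: their rows of [A] vanish in the
   last column. *)
have phi'_xx i x t : pdxn 2 (phi' i) x t = - \sum_j A' i j * phi' j x t.
  have lt_max : (lift ord_max i < @ord_max n.+1)%N by rewrite -lift_widen /=.
  rewrite phi_xx big_ord_recr (A_trig _ _ lt_max) mul0r /= addr0.
  by congr (- _); apply: eq_bigr => j _; rewrite lift_widen mxE.
have phi'_t i x t : pdt (phi' i) x t = - 4%:R * pdxn 3 (phi' i) x t.
  exact: phi_t.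
have fE : f = wtau phi 0.
  by apply/funext => x; apply/funext => t; rewrite -wr_jet.
have gE : g = wtau phi' 0.
  apply/funext => x; apply/funext => t; rewrite -wr_jet.
  rewrite /g (det_bordered (jet phi x t)); apply: eq_wr => j /=.
  by rewrite /bump leqNgt ltn_ord.
have bilinear k x t : wtau phi 0 x t * wtau phi' k.+1 x t =
    wtau phi k x t * wtau phi' 1 x t -
    (wtau_x phi k x t - wtau phi k.+1 x t) * wtau phi' 0 x t.
  by rewrite -!wr_jet; exact: (plucker (jet phi x t) k).
have bil1 x t : wtau phi 0 x t * wtau phi' 2 x t +
     wtau phi 2 x t * wtau phi' 0 x t =
   wtau phi 1 x t * wtau phi' 1 x t +
   - \tr A * (wtau phi 0 x t * wtau phi' 0 x t).
  by rewrite bilinear (wtau_x1 phi_smooth phi_xx); ring.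
move=> x t.
(* This is [bil1] differentiated in [x], by uniqueness of the derivative of its two sides. *)
have dbil1 : wtau_x phi 0 x t * wtau phi' 2 x t +
      wtau phi 0 x t * wtau_x phi' 2 x t +
    (wtau_x phi 2 x t * wtau phi' 0 x t + wtau phi 2 x t * wtau_x phi' 0 x t) =
    wtau_x phi 1 x t * wtau phi' 1 x t + wtau phi 1 x t * wtau_x phi' 1 x t +
    - \tr A * (wtau_x phi 0 x t * wtau phi' 0 x t +
               wtau phi 0 x t * wtau_x phi' 0 x t).
  have dF r := is_cderive_wtau phi_smooth r x t.
  have dG r := is_cderive_wtau phi'_smooth r x t.
  apply: (is_cderive_unique
    (is_cderiveD (is_cderiveM (dF 0) (dG 2)) (is_cderiveM (dF 2) (dG 0)))).
  have -> : (fun y => wtau phi 0 y t * wtau phi' 2 y t +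
      wtau phi 2 y t * wtau phi' 0 y t) = (fun y => wtau phi 1 y t * wtau phi' 1 y t +
     - \tr A * (wtau phi 0 y t * wtau phi' 0 y t)).
    by apply/funext => y; exact: bil1.
  apply: is_cderiveD; first exact: is_cderiveM.
  by apply: is_cderiveZ; exact: is_cderiveM.
rewrite hirota_x hirota_t hirota_xx hirota_xxx fE gE.
rewrite !pdx_wtau0 // (pdx_pdx_wtau1 phi_smooth phi_xx).
rewrite (pdx_pdx_wtau1 phi'_smooth phi'_xx).
rewrite (pdx_wtau1 phi_smooth phi_xx) (pdx_wtau1 phi'_smooth phi'_xx).
rewrite (pdt_wtau0 phi_smooth phi_xx phi_t) (pdt_wtau0 phi'_smooth phi'_xx phi'_t).
move: dbil1 (bil1 x t) (bilinear 2 x t).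
rewrite !wtau_x0.
rewrite (wtau_x1 phi_smooth phi_xx) (wtau_x1 phi'_smooth phi'_xx) trA.
move: (wtau_x phi 2 x t) (wtau_x phi' 2 x t) (\tr A') (wtau phi 0 x t)
  (wtau phi 1 x t) (wtau phi 2 x t) (wtau phi 3 x t) (wtau phi' 0 x t)
  (wtau phi' 1 x t) (wtau phi' 2 x t) (wtau phi' 3 x t) (lambda).
move=> df dg T f0 f1 f2 f3 g0 g1 g2 g3 l.
move=> /eqP; rewrite -subr_eq0 => /eqP d1.
move=> /eqP; rewrite -subr_eq0 => /eqP b1.
move=> /eqP; rewrite -subr_eq0 => /eqP b2.
split.
  (* The first equation is twice [b1]: the traces combine to [\tr A' - \tr A], which is [lambda]. *)
  by apply/eqP; rewrite -subr_eq0; apply/eqP; rewrite -(mulr0 2) -b1; ring.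
(* The second equation is 12 times [b2] minus 6 times [d1]. The 12 matches the terms in [f3] and
   [g3] of the [t]-derivatives; the 6 then leaves [6 * (df * g0 - f0 * dg)], as produced by the
   third [x]-derivatives and the [t]-derivatives together. *)
transitivity (12 * 0 - 6 * 0 : R[i]); last by rewrite !mulr0 subrr.
by rewrite -{1}b2 -d1; ring.
Qed.
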